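(* Let $N$ be a positive integer and let $q$ be a prime power with $q\geq N^2$. Let $i,k$ be non-negative integers with $i\leq\lfloor N/2\rfloor$ and $k\leq N-1$. Then the union of $i$ lines and $k$ Baer subplanes in $\mathrm{PG}(N,q)$ is not a strong blocking set.
   Context: $\mathrm{PG}(N,q)$ denotes the $N$-dimensional projective space over the finite field $\mathbb{F}_q$. A strong blocking set in $\mathrm{PG}(N,q)$ is a set of points $\mathcal{S}$ such that for every hyperplane $H$, the points of $\mathcal{S}\cap H$ span $H$. A Baer subplane of $\mathrm{PG}(N,q)$ (which exists only when $q$ is a square) is the point set of a subgeometry $\mathrm{PG}(2,\sqrt{q})$ of a plane of $\mathrm{PG}(N,q)$, i.e. the set of points $\langle a u+b v+c w\rangle_{\mathbb{F}_q}$ with $(a,b,c)\in\mathbb{F}_{\sqrt q}^3\setminus\{0\}$, for some $\mathbb{F}_q$-linearly independent vectors $u,v,w$. *)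

(* Defs.v *)
From HB Require Import structures.
From mathcomp Require Import all_boot all_order all_algebra.

Set Implicit Arguments.
Unset Strict Implicit.
Unset Printing Implicit Defensive.

Import GRing.Theory.
Local Open Scope ring_scope.

Section ProjectiveSpace.

Variables (F : finFieldType) (N : nat).

Definition pg_point : Type :=
  {P : {vspace 'rV[F]_N.+1} | \dim P == 1%N}.

HB.instance Definition _ := SubChoice.on pg_point.

(* A point is determined by its set of vectors, hence there are finitely many. *)
Definition vectors_of_point (P : pg_point) : {set 'rV[F]_N.+1} :=
  [set v | v \in val P].

Definition point_of_vectors (A : {set 'rV[F]_N.+1}) : option pg_point :=
  insub <<enum A>>%VS.

Lemma vectors_of_pointK : pcancel vectors_of_point point_of_vectors.
Proof.
move=> P; rewrite /point_of_vectors.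
suff -> : <<enum (vectors_of_point P)>>%VS = val P by rewrite valK.
apply/eqP; rewrite eqEsubv; apply/andP; split.
  by apply/span_subvP => v; rewrite mem_enum inE.
by apply/subvP => v vP; apply: memv_span; rewrite mem_enum inE.
Qed.

HB.instance Definition _ := PCanIsCountable vectors_of_pointK.
HB.instance Definition _ : isFinite pg_point :=
  PCanIsFinite vectors_of_pointK.

Definition points_in (U : {vspace 'rV[F]_N.+1}) : {set pg_point} :=
  [set P | (val P <= U)%VS].

Definition pg_span (X : {set pg_point}) : {vspace 'rV[F]_N.+1} :=
  (\sum_(P in X) val P)%VS.

(* A subspace of projective dimension d has vector space dimension d.+1. *)
Definition hyperplane (H : {vspace 'rV[F]_N.+1}) : Prop := \dim H = N.

Definition strong_blocking_set (S : {set pg_point}) : Prop :=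
  forall H, hyperplane H -> pg_span (S :&: points_in H) = H.

Definition is_line (L : {set pg_point}) : Prop :=
  exists2 U : {vspace 'rV[F]_N.+1}, \dim U = 2%N & L = points_in U.

Definition subgeometry_points (K : {set F}) (u v w : 'rV[F]_N.+1) :
    {set pg_point} :=
  [set P | [exists a in K, exists b in K, exists c in K,
     ~~ [&& a == 0, b == 0 & c == 0] &&
     (val P == <[a *: u + b *: v + c *: w]>%VS)]].

(* divring_closed K together with the cardinality condition says that K is   *)
(* the subfield of order sqrt(#|F|); there is none unless #|F| is a square.  *)
Definition is_baer_subplane (B : {set pg_point}) : Prop :=
  exists (K : {set F}) (u v w : 'rV[F]_N.+1),
    [/\ GRing.divring_closed K, (#|K| ^ 2 = #|F|)%N, free [:: u; v; w]
      & B = subgeometry_points K u v w].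

End ProjectiveSpace.

(* Main.v *)
Require Import Defs.
From mathcomp Require Import all_boot all_order all_algebra.
From mathcomp Require Import ring zify.

(** A hyperplane H violates the strong blocking property as soon as S meets it
    inside a proper subspace of H; it is enough to find two independent linear
    forms f, g and a scalar t such that every point of S on the hyperplane
    g + t f = 0 also lies on f = 0.

    Since twice the number of lines is at most N, some nonzero form f vanishes
    on all the lines ([exists_form_vanishing_on_lines]), which therefore never
    obstruct the choice of t.  A Baer subplane B always has a point p with
    f p = 0: on the underlying space K^3, where K is the subfield of order
    s = sqrt q, the form f is a K-linear map to a space with only s^2 elements
    ([exists_subfield_relation]).  There are at most N - 1 of these points, so
    some g that is independent from f vanishes at all of them.

    A point x of B with f x <> 0 is bad for exactly one t, namely
    t = - g x / f x.  As f and g both vanish at p, this value depends only on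
    the K-line through p and x, and there are s + 1 such lines
    ([pencil_parameters_boundP]).  Altogether at most
    (N - 1) (s + 1) <= (s - 1) (s + 1) = q - 1
    values of t are bad, because N <= s; so one of the q scalars is good. *)

Set Implicit Arguments.
Unset Strict Implicit.
Unset Printing Implicit Defensive.

Import GRing.Theory.
Local Open Scope ring_scope.

(** * Counting and linear forms *)

Lemma exists_notin_bigcup (T : finType) (k : nat) (R : 'I_k -> {set T}) :
  (\sum_(j < k) #|R j| < #|T|)%N -> exists t, t \notin \bigcup_(j < k) R j.
Proof.
move=> lt_sum; apply/existsP; rewrite -negb_forall.
apply: contraTN lt_sum => /forallP allR; rewrite -leqNgt.
have -> : #|T| = #|\bigcup_(j < k) R j| by apply: eq_card => x; rewrite allR.
elim/big_ind2: _ => [|m A n C leAm leCn|//]; first by rewrite cards0.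
by rewrite (leq_trans (leq_card_setU A C)) // leq_add.
Qed.

Section LinearForms.

Variables (F : fieldType) (V : vectType F).

(** The form is a coordinate of the projection onto a complement of U.  The
    vector z on which it takes the value 1 is what makes it possible to choose
    a second form independent from the first: let that one vanish at z. *)
Lemma exists_form_vanishing_on (U : {vspace V}) :
  (\dim U < dim V)%N ->
  exists (f : 'Hom(V, F^o)) (z : V), f z = 1 /\ (U <= lker f)%VS.
Proof.
move=> ltUV.
have: (0 < \dim U^C)%N by rewrite dimv_compl dimvf subn_gt0.
move: (vbasisP U^C); case: (\dim _) (vbasis _) => [//|n] X Xbasis _.
have freeX := basis_free Xbasis.
have capCU : (U^C :&: U)%VS = 0%VS by rewrite capvC capv_compl.
pose f := (linfun (coord X ord0 : V -> F^o) \o daddv_pi U^C U)%VF.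
exists f, X`_0; split.
  rewrite comp_lfunE /= daddv_pi_id //.
    by rewrite lfunE /= (coord_free ord0 ord0 freeX).
  by rewrite (basis_mem Xbasis) // mem_nth // size_tuple.
apply/subvP => v Uv; rewrite memv_ker comp_lfunE /=.
have v_decomp : daddv_pi U U^C v + daddv_pi U^C U v = v.
  by rewrite daddv_pi_add ?capv_compl // addv_complf memvf.
suff -> : daddv_pi U^C U v = 0 by rewrite linear0.
apply: (addrI (daddv_pi U U^C v)).
by rewrite v_decomp daddv_pi_id ?capv_compl // addr0.
Qed.

Lemma dim_lker_form (f : 'Hom(V, F^o)) (z : V) :
  f z != 0 -> \dim (lker f) = (dim V).-1.
Proof.
move=> fz; have := limg_ker_dim f fullv.
rewrite capfv dimvf => <-.
suff -> : \dim (f @: fullv) = 1%N by rewrite addn1.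
apply/eqP; rewrite eqn_leq; apply/andP; split.
  have := dimvS (subvf (f @: fullv)%VS).
  by rewrite dimvf.
rewrite lt0n dimv_eq0; apply/eqP => im0.
have : f z \in (f @: fullv)%VS by rewrite memv_img ?memvf.
by rewrite im0 memv0 (negbTE fz).
Qed.

End LinearForms.

(** * Linear forms on a Baer subplane, in coordinates over the subfield *)

Section SubfieldCoefficients.

Variables (F : finFieldType) (K : {set F}).
Hypotheses (K_subfield : GRing.divring_closed K)
           (K_sqrt : (#|K| ^ 2 = #|F|)%N).

(** Pigeonhole: K^3 has more elements than F, so two triples take the same
    value, and their difference is a relation. *)
Lemma exists_subfield_relation (f1 f2 f3 : F) :
  exists a b c, [/\ a \in K, b \in K, c \in K,
    ~~ [&& a == 0, b == 0 & c == 0] & a * f1 + b * f2 + c * f3 = 0].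
Proof.
have [K1 KB _] := K_subfield.
pose D := setX (setX K K) K.
pose phi (x : F * F * F) := x.1.1 * f1 + x.1.2 * f2 + x.2 * f3.
have K0 : 0 \in K by rewrite -(subrr 1) KB.
have K_gt1 : (1 < #|K|)%N.
  have <- : #|[set 0; 1 : F]| = 2%N by rewrite cards2 eq_sym oner_neq0.
  by apply: subset_leq_card; apply/subsetP => x; rewrite !inE => /orP[] /eqP->.
have : ~~ dinjectiveb phi D.
  apply/negP => /dinjectiveP/card_in_imset card_phiD.
  have := max_card [set phi x | x in D].
  rewrite card_phiD !cardsX -K_sqrt; nia.
case/dinjectivePn => [[[a b] c]] Dx [[[a' b'] c']] /andP[/= ne Dy] eq_phi.
move: Dx Dy; rewrite !inE /= => /andP[/andP[Ka Kb] Kc].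
case/andP=> /andP[Ka' Kb'] Kc'.
exists (a - a'), (b - b'), (c - c'); split; rewrite ?KB //.
  by apply: contra ne; rewrite !subr_eq0 => /and3P[/eqP-> /eqP-> /eqP->].
transitivity (phi (a, b, c) - phi (a', b', c')); first by rewrite /phi /=; ring.
by rewrite eq_phi subrr.
Qed.

(** Two linear forms f, g on a Baer subplane are given by their values fi, gi at
    the three vectors that span it.  The set R contains the parameters t for
    which the member g + t f of their pencil vanishes at a point of the
    subplane that is off the line f = 0. *)
Definition pencil_parameters_bound (f1 f2 f3 g1 g2 g3 : F) :=
  exists R : {set F}, (#|R| <= #|K|.+1)%N /\
    forall a b c t, a \in K -> b \in K -> c \in K ->
      a * f1 + b * f2 + c * f3 != 0 ->
      a * g1 + b * g2 + c * g3 + t * (a * f1 + b * f2 + c * f3) = 0 ->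
      t \in R.

(** Modulo the common zero (a0, b0, c0) of f and g, any coefficient triple can
    be moved to one with first entry 0.  The ratio g / f is unchanged, and it
    is then also invariant under scaling: only the #|K| + 1 points of the
    projective line over K remain, namely (1 : r) and (0 : 1). *)
Lemma pencil_parameters_bound_lead (f1 f2 f3 g1 g2 g3 a0 b0 c0 : F) :
  a0 \in K -> b0 \in K -> c0 \in K -> a0 != 0 ->
  a0 * f1 + b0 * f2 + c0 * f3 = 0 -> a0 * g1 + b0 * g2 + c0 * g3 = 0 ->
  pencil_parameters_bound f1 f2 f3 g1 g2 g3.
Proof.
have [K1 KB KV] := K_subfield.
have K0 : 0 \in K by rewrite -(subrr 1) KB.
have KM x y : x \in K -> y \in K -> x * y \in K.
  move=> Kx Ky; rewrite -[y]invrK KV // -[y^-1]div1r.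
  exact: KV.
move=> Ka0 Kb0 Kc0 a0_neq0 f0 g0.
have elim_lead (h1 h2 h3 a b c : F) : a0 * h1 + b0 * h2 + c0 * h3 = 0 ->
  a * h1 + b * h2 + c * h3 = (b - a / a0 * b0) * h2 + (c - a / a0 * c0) * h3.
  move=> h0; apply/eqP; rewrite -subr_eq0; apply/eqP.
  transitivity (a / a0 * (a0 * h1 + b0 * h2 + c0 * h3)); first by field.
  by rewrite h0 mulr0.
(* The points (0 : 1) and (1 : r), in this order. *)
exists ((- (g3 / f3)) |: [set - ((g2 + r * g3) / (f2 + r * f3)) | r in K]).
split.
  by rewrite cardsU1 -add1n leq_add ?leq_b1 ?leq_imset_card.
move=> a b c t Ka Kb Kc; rewrite (elim_lead f1) // (elim_lead g1) //.
have : b - a / a0 * b0 \in K by rewrite KB // KM // KV.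
have : c - a / a0 * c0 \in K by rewrite KB // KM // KV.
move: (b - _) (c - _) => y z Kz Ky f_neq0 gtf0; rewrite in_setU1.
have t_eq : t = - ((y * g2 + z * g3) / (y * f2 + z * f3)).
  apply: (mulIf f_neq0); rewrite mulNr divfK //.
  by apply/eqP; rewrite -subr_eq0 opprK addrC gtf0.
have [y0|y_neq0] := eqVneq y 0.
  apply/orP; left; rewrite t_eq y0 !mul0r !add0r.
  have z_neq0 : z != 0.
    by apply: contraNneq f_neq0 => z0; rewrite y0 z0 !mul0r addr0.
  by rewrite -mulf_div divff // mul1r.
apply/orP; right; apply/imsetP; exists (z / y); first exact: KV.
have scale h2 h3 : y * h2 + z * h3 = y * (h2 + z / y * h3)
  by field.
by rewrite t_eq !scale -mulf_div divff // mul1r.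
Qed.

(** Permuting the three spanning vectors brings a nonzero coefficient of the
    common zero to the front. *)
Lemma pencil_parameters_boundP (f1 f2 f3 g1 g2 g3 a0 b0 c0 : F) :
  a0 \in K -> b0 \in K -> c0 \in K -> ~~ [&& a0 == 0, b0 == 0 & c0 == 0] ->
  a0 * f1 + b0 * f2 + c0 * f3 = 0 -> a0 * g1 + b0 * g2 + c0 * g3 = 0 ->
  pencil_parameters_bound f1 f2 f3 g1 g2 g3.
Proof.
move=> Ka0 Kb0 Kc0 nz f0 g0.
have [a00|a0_neq0] := eqVneq a0 0; last first.
  exact: (pencil_parameters_bound_lead Ka0 Kb0 Kc0).
have swap12 (h1 h2 h3 a b c : F) :
    a * h1 + b * h2 + c * h3 = b * h2 + a * h1 + c * h3.
  by ring.
have swap13 (h1 h2 h3 a b c : F) :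
    a * h1 + b * h2 + c * h3 = c * h3 + b * h2 + a * h1.
  by ring.
have [b00|b0_neq0] := eqVneq b0 0.
  have c0_neq0 : c0 != 0 by move: nz; rewrite a00 b00 !eqxx.
  case: (@pencil_parameters_bound_lead f3 f2 f1 g3 g2 g1 c0 b0 a0) => //;
    try by rewrite -swap13.
  move=> R [cardR inR]; exists R; split=> // a b c t Ka Kb Kc.
  rewrite (swap13 f1) (swap13 g1); exact: inR.
case: (@pencil_parameters_bound_lead f2 f1 f3 g2 g1 g3 b0 a0 c0) => //;
  try by rewrite -swap12.
move=> R [cardR inR]; exists R; split=> // a b c t Ka Kb Kc.
rewrite (swap12 f1) (swap12 g1); exact: inR.
Qed.

End SubfieldCoefficients.

(** * Lines and Baer subplanes *)

Section ProjectiveSpace.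

Variables (F : finFieldType) (N : nat).
Local Notation V := 'rV[F]_N.+1.
Implicit Types f g : 'Hom(V, F^o).

(** The point p depends on f only, so that g can be required to vanish at the
    points p of several subplanes simultaneously. *)
Lemma baer_subplane_pencil (B : {set pg_point F N}) f :
  is_baer_subplane B ->
  exists (s : nat) (p : V), [/\ (s ^ 2 = #|F|)%N, f p = 0 &
    forall g, g p = 0 -> exists R : {set F}, (#|R| <= s.+1)%N /\
      forall (P : pg_point F N) t, P \in B ->
        (val P <= lker (g + t *: f)%R)%VS -> t \notin R ->
        (val P <= lker f)%VS].
Proof.
case=> K [u] [v] [w] [K_subfield K_sqrt _ ->].
have comb (h : 'Hom(V, F^o)) a b c :
    h (a *: u + b *: v + c *: w) = a * (h u) + b * (h v) + c * (h w).
  by rewrite !linearD !linearZ.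
have [a0 [b0 [c0 [Ka0 Kb0 Kc0 nz f0]]]] :=
  exists_subfield_relation K_subfield K_sqrt (f u) (f v) (f w).
exists #|K|, (a0 *: u + b0 *: v + c0 *: w); split=> //; first by rewrite comb.
move=> g; rewrite comb => g0.
have [R [cardR inR]] :=
  pencil_parameters_boundP K_subfield Ka0 Kb0 Kc0 nz f0 g0.
exists R; split=> // P t.
rewrite inE => /exists_inP[a Ka] /exists_inP[b Kb] /exists_inP[c Kc].
case/andP=> _ /eqP->; rewrite -!memvE !memv_ker add_lfunE scale_lfunE !comb.
move=> /eqP gtf0; apply: contraNT => f_neq0.
exact: (inR a b c).
Qed.

Lemma dim_sum_points_leq (k : nat) (p : 'I_k -> V) :
  (\dim (\sum_(j < k) <[p j]>) <= k)%N.
Proof.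
apply: leq_trans (dimv_leq_sum _ _ _) _.
rewrite -[X in (_ <= X)%N]card_ord -sum1_card leq_sum // => j _.
by rewrite dim_vline leq_b1.
Qed.

(** The lines span a space of dimension at most 2 (N %/ 2) <= N. *)
Lemma exists_form_vanishing_on_lines (i : nat)
    (L : 'I_i -> {set pg_point F N}) :
  (i <= N %/ 2)%N -> (forall j, is_line (L j)) ->
  exists f (z : V), f z = 1 /\
    forall j P, P \in L j -> (val P <= lker f)%VS.
Proof.
move=> le_i /fin_all_exists2[U dimU defL].
have [|f [z [fz1 Uf]]] := @exists_form_vanishing_on F V (\sum_(j < i) U j).
  rewrite dim_matrix mul1r ltnS; apply: leq_trans (dimv_leq_sum _ _ _) _.
  under eq_bigr do rewrite dimU.
  rewrite sum_nat_const card_ord; lia.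
exists f, z; split=> // j P; rewrite defL inE => PU.
by apply: subv_trans PU (subv_trans _ Uf); rewrite (sumv_sup j).
Qed.

End ProjectiveSpace.

(** * The union is not a strong blocking set *)

Theorem corollary2p3 (F : finFieldType) (N i k : nat)
  (hN : (0 < N)%N) (hq : (N ^ 2 <= #|F|)%N)
  (hi : (i <= N %/ 2)%N) (hk : (k <= N.-1)%N)
  (L : 'I_i -> {set pg_point F N}) (hL : forall j, is_line (L j))
  (B : 'I_k -> {set pg_point F N}) (hB : forall j, is_baer_subplane (B j)) :
  ~ strong_blocking_set ((\bigcup_(j < i) L j) :|: (\bigcup_(j < k) B j)).
Proof.
move=> blocking.
have [f [z [fz1 fL]]] := exists_form_vanishing_on_lines hi hL.
have [s /fin_all_exists[p fB]] :=
  fin_all_exists (fun j => baer_subplane_pencil f (hB j)).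
(* At most 1 + (N - 1) vectors are to be annihilated; the vector z makes g
   independent from f. *)
have [|g [y0 [gy0 gvanish]]] :=
  @exists_form_vanishing_on F 'rV[F]_N.+1 (<[z]> + \sum_(j < k) <[p j]>).
  rewrite dim_matrix mul1r ltnS; apply: leq_trans (dimv_add_leqif _ _) _.
  rewrite dim_vline.
  apply: leq_trans (leq_add (leq_b1 _) (dim_sum_points_leq p)) _; lia.
have gz0 : g z = 0.
  by apply/eqP; rewrite -memv_ker memvE (subv_trans (addvSl _ _) gvanish).
have gp0 j : g (p j) = 0.
  apply/eqP; rewrite -memv_ker memvE; apply: subv_trans gvanish.
  by rewrite (subv_trans _ (addvSr _ _)) // (sumv_sup j).
(* With z, the vector y forms a dual basis of (f, g). *)
have [y [fy0 gy1]] : exists y, f y = 0 /\ g y = 1.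
  exists (y0 - f y0 *: z); split; rewrite linearB linearZ /=.
    by rewrite fz1 [_ *: 1]mulr1 subrr.
  by rewrite gy0 gz0 scaler0 subr0.
have /fin_all_exists[R pencil] j : exists Rj : {set F},
    (#|Rj| <= (s j).+1)%N /\ forall (P : pg_point F N) t, P \in B j ->
      (val P <= lker (g + t *: f)%R)%VS -> t \notin Rj -> (val P <= lker f)%VS.
  by have [_ _ pencil] := fB j; apply: pencil.
(* The number of subplanes is at most s - 1, each excluding at most s + 1
   values. *)
have [t tR] : exists t, t \notin \bigcup_(j < k) R j.
  apply: exists_notin_bigcup.
  have F_gt0 : (0 < #|F|)%N by apply/card_gt0P; exists 0.
  have [k0|k_gt0] := posnP k.
    by rewrite big1 // => j _; have := leq_trans (ltn_ord j) (eq_leq k0).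
  have : (\sum_(j < k) N.-1 * #|R j| <= \sum_(j < k) #|F|.-1)%N.
    apply: leq_sum => j _; have [sq _ _] := fB j; have [leR _] := pencil j.
    have leNs : (N <= s j)%N by rewrite -(leq_exp2r _ _ (ltn0Sn 1)) sq.
    rewrite -!subn1 -sq -[X in (_ <= _ - X)%N](exp1n 2) subn_sqr addn1.
    exact: leq_mul (leq_sub2r 1 leNs) leR.
  rewrite -big_distrr sum_nat_const card_ord /= => le_sum.
  have := leq_trans le_sum (leq_mul hk (leqnn _)).
  by rewrite leq_pmul2l ?(leq_trans k_gt0 hk) // -ltnS prednK.
(* This is where strong blocking is used: the points of the union on the
   hyperplane g + t f = 0 span it, and they all satisfy f = 0. *)
have le_ker : (lker (g + t *: f)%R <= lker f)%VS.
  have ker_hyperplane : hyperplane (lker (g + t *: f)%R).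
    have hy1 : (g + t *: f) y != 0.
      by rewrite add_lfunE scale_lfunE gy1 fy0 scaler0 addr0 oner_neq0.
    by rewrite /hyperplane (dim_lker_form hy1) dim_matrix mul1r.
  rewrite -[X in (X <= _)%VS](blocking _ ker_hyperplane).
  apply/subv_sumP => P; rewrite !inE => /andP[/orP[]].
    by case/bigcupP=> j _ /fL.
  case/bigcupP=> j _ PB Pker.
  apply: (proj2 (pencil j) P t PB Pker).
  by apply: contra tR => tRj; apply/bigcupP; exists j.
(* The vector z - t y contradicts this inclusion. *)
have fx1 : f (z - t *: y) = 1.
  by rewrite linearB linearZ /= fz1 fy0 scaler0 subr0.
have gxt : g (z - t *: y) = - t.
  by rewrite linearB linearZ /= gz0 gy1 [_ *: 1]mulr1 sub0r.
have : z - t *: y \in lker f.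
  apply: (subvP le_ker); rewrite memv_ker add_lfunE scale_lfunE gxt fx1.
  by rewrite [_ *: 1]mulr1 addNr.
by rewrite memv_ker fx1 oner_eq0.
Qed.
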